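(* Let $p_L(z,w)=6-\left(w+\frac1w+z+\frac1z+\frac wz+\frac zw\right)$. Then $$2\pi\,\mathrm{m}(p_L)=10\,D\!\left(\frac{1+\sqrt3\,i}{2}\right)=10\,v_{\mathrm{tet}}.$$
   Context: Mahler measure: $\mathrm{m}(P)=\frac{1}{(2\pi i)^2}\int_{|z|=|w|=1}\log|P(z,w)|\frac{dz}{z}\frac{dw}{w}$. $D$ is the Bloch–Wigner dilogarithm $D(z)=\operatorname{Im}(\mathrm{Li}_2(z))+\arg(1-z)\log|z|$, with $\mathrm{Li}_2(z)=-\int_0^z\frac{\log(1-t)}{t}dt$. $v_{\mathrm{tet}}=D(e^{i\pi/3})\approx1.01494$ is the volume of the regular ideal hyperbolic tetrahedron. *)

(* Defs.v *)
From Stdlib Require Import Reals Lra.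
Open Scope R_scope.

Definition C : Type := (R * R)%type.
Definition Cre (z : C) : R := fst z.
Definition Cim (z : C) : R := snd z.
Definition Cof (x : R) : C := (x, 0).
Definition Cadd (z w : C) : C := (Cre z + Cre w, Cim z + Cim w).
Definition Csub (z w : C) : C := (Cre z - Cre w, Cim z - Cim w).
Definition Cmul (z w : C) : C :=
  (Cre z * Cre w - Cim z * Cim w, Cre z * Cim w + Cim z * Cre w).
Definition Cinv (z : C) : C :=
  let d := Cre z ^ 2 + Cim z ^ 2 in (Cre z / d, - Cim z / d).
Definition Cdiv (z w : C) : C := Cmul z (Cinv w).
Definition Cscale (s : R) (z : C) : C := (s * Cre z, s * Cim z).
Definition Cnorm (z : C) : R := sqrt (Cre z ^ 2 + Cim z ^ 2).
Definition Cexpi (t : R) : C := (cos t, sin t).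

Definition Carg (z : C) : R :=
  let x := Cre z in let y := Cim z in
  if Rlt_dec 0 x then atan (y / x)
  else if Rlt_dec x 0 then
    (if Rle_dec 0 y then atan (y / x) + PI else atan (y / x) - PI)
  else if Rlt_dec 0 y then PI / 2
  else if Rlt_dec y 0 then - (PI / 2) else 0.

Definition is_RInt (f : R -> R) (a b v : R) : Prop :=
  exists pr : Riemann_integrable f a b, RiemannInt pr = v.

Definition is_iter_RInt (F : R -> R -> R) (a b v : R) : Prop :=
  exists g : R -> R,
    (forall x, is_RInt (fun y => F x y) a b (g x)) /\ is_RInt g a b v.

(** Mahler measure of a two-variable function P (here a Laurent polynomial):
    m(P) = (1/(2 pi i))^2 int_{|z|=|w|=1} log|P(z,w)| dz/z dw/w
         = 1/(4 pi^2) int_0^{2pi} int_0^{2pi} log|P(e^{it}, e^{is})| ds dt.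
    Since log|P| has (integrable) singularities on the torus, the integral is
    taken as the monotone limit of the integrals of log(max(1/(n+1), |P|)),
    which are continuous; by monotone convergence this is the Lebesgue
    integral of log|P|. [is_mahler P m] means m(P) = m. *)
Definition is_mahler (P : C -> C -> C) (m : R) : Prop :=
  exists h : nat -> R,
    (forall n : nat,
        is_iter_RInt
          (fun t s => ln (Rmax (/ INR (S n)) (Cnorm (P (Cexpi t) (Cexpi s)))))
          0 (2 * PI) (h n)) /\
    Un_cv h (4 * PI ^ 2 * m).

(** Bloch--Wigner dilogarithm D(z) = Im(Li_2(z)) + arg(1-z) log|z|, with
    Li_2(z) = - int_0^z log(1-t)/t dt along the segment t = s z, s in [0,1],
    principal branch of log; so Im Li_2(z) = - int_0^1 arg(1 - s z)/s ds.
    [is_BW z v] means D(z) = v. *)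
Definition is_BW (z : C) (v : R) : Prop :=
  exists I : R,
    is_RInt (fun s => Carg (Csub (Cof 1) (Cscale s z)) / s) 0 1 I /\
    v = - I + Carg (Csub (Cof 1) z) * ln (Cnorm z).

Definition pL (z w : C) : C :=
  Csub (Cof 6)
    (Cadd w (Cadd (Cinv w) (Cadd z (Cadd (Cinv z) (Cadd (Cdiv w z) (Cdiv z w)))))).

(* Main.v *)
(** The symbol p_L is the member e = 1 of the family of weighted triangular
    lattice Laplacians
      p_e = 2 (1 - cos x) + e (2 - 2 cos t) + e (2 - 2 cos (t - x)).
    Jensen's formula evaluates the inner integral of log p_e explicitly, and the
    resulting single integral K(e) has the elementary e-derivative
    4 arccos (1 / (1 + e)) / e, while K(e) tends to 0 as e tends to 0.  With
    1 + e = 1 / cos b this makes K(1) the integral over (0, pi/3) of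
    4 b (cot (b/2) + tan b).  The same integrals of t cot t express D(e^(i pi/3)), by the law of
    sines, and the duplication and reflection formulas of the Lobachevsky
    function match the two. *)
From Coquelicot Require Import Coquelicot.
From Stdlib Require Import Lra Lia.
Require Import Defs.
From Stdlib Require Import Reals.
Open Scope R_scope.

(** * The integral of t cot t *)

(** At e = 0 the Jensen value of the inner integral degenerates to ln (4 sin^2(x/2)), which is
    unbounded, so K(0) cannot be read off as a Riemann integral and the constant of integration must
    come from a limit. It is found by a sandwich: the integrand of K(e) lies between two functions
    ln (A - 2 cos x) with A tending to 2, and Jensen's formula shows that their integrals tend to 0.
    The zero of p_L at z = w = 1 is treated in the same way. On the torus p_L is real and
    nonnegative, so max(d, p_L) lies between p_L and p_L + d. Both have the form A - B cos, Jensen's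
    formula evaluates both, and no convergence theorem for integrals is involved. The factor 10
    arises because K(1) = 20 Phi(pi/6), while D(e^(i pi/3)) = 2 Phi(pi/6). *)

Definition sinc (x : R) : R := if Req_EM_T x 0 then 1 else sin x / x.
(** Dividing by [sinc] gives x cot x its limit 1 at 0, where [x * (cos x / sin x)] would evaluate to
    0. *)
Definition tcot (x : R) : R := cos x / sinc x.
(* The Lobachevsky function is [fun x => Phi x - x * ln (2 * sin x)]; unlike it, [Phi] is
   differentiable at 0. *)
Definition Phi (x : R) : R := RInt tcot 0 x.

Lemma tcot_0 : tcot 0 = 1.
Proof. unfold tcot, sinc; destruct (Req_EM_T 0 0); [rewrite cos_0; lra | lra]. Qed.

(** At nonzero multiples of pi the convention [/ 0 = 0] makes both sides 0. *)
Lemma tcot_neq0 (x : R) : x <> 0 -> tcot x = x * (cos x / sin x).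
Proof.
intros Hx; unfold tcot, sinc, Rdiv.
destruct (Req_EM_T x 0); [easy | rewrite Rinv_mult, Rinv_inv; ring].
Qed.

Lemma continuous_sinc (x : R) : continuous sinc x.
Proof.
destruct (Req_dec x 0) as [-> | Hx].
- apply continuity_pt_filterlim.
  intros eps Heps.
  (* The difference quotient of sin at 0 is [sinc] itself, so sin'(0) = 1 is exactly the continuity
     wanted. *)
  destruct (derivable_pt_lim_sin_0 eps Heps) as [del Hdel].
  exists del; split; [apply cond_pos |].
  intros h [[_ Hh] Hdist]; simpl in *; unfold Rdist in *.
  rewrite Rminus_0_r in Hdist.
  specialize (Hdel h (not_eq_sym Hh) Hdist).
  unfold sinc; destruct (Req_EM_T 0 0); [| lra]; destruct (Req_EM_T h 0); [lra |].
  now rewrite Rplus_0_l, sin_0, Rminus_0_r in Hdel.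
- apply continuous_ext_loc with (fun t => sin t / t).
  + exists (mkposreal _ (Rabs_pos_lt _ Hx)); intros y Hy.
    unfold ball in Hy; simpl in Hy; unfold AbsRing_ball, abs, minus, plus, opp in Hy; simpl in Hy.
    unfold sinc; destruct (Req_EM_T y 0) as [-> |]; [| easy].
    rewrite Rplus_0_l, Rabs_Ropp in Hy; lra.
  + apply (@ex_derive_continuous R_AbsRing R_NormedModule); now auto_derive.
Qed.

Lemma sinc_neq0 (x : R) : - PI < x < PI -> sinc x <> 0.
Proof.
intros Hx; unfold sinc; destruct (Req_EM_T x 0) as [| Hx0]; [lra |].
assert (sin x <> 0).
{ destruct (Rtotal_order x 0) as [H | [H | H]]; [| easy |].
  - apply Rlt_not_eq; rewrite <- (Ropp_involutive x), sin_neg.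
    apply Ropp_lt_gt_0_contravar, sin_gt_0; lra.
  - apply Rgt_not_eq, sin_gt_0; lra. }
unfold Rdiv; apply Rmult_integral_contrapositive; split; [easy | now apply Rinv_neq_0_compat].
Qed.

Lemma continuous_tcot (x : R) : - PI < x < PI -> continuous tcot x.
Proof.
intros Hx; unfold tcot, Rdiv.
apply (continuous_mult cos (fun t => / sinc t)); [apply continuous_cos |].
apply continuous_comp; [apply continuous_sinc |].
now apply continuous_Rinv, sinc_neq0.
Qed.

Lemma is_derive_Phi (x : R) : - PI < x < PI -> is_derive Phi x (tcot x).
Proof.
intros Hx; apply is_derive_RInt with 0; [| now apply continuous_tcot].
assert (He : 0 < Rmin (PI - x) (x + PI)) by (apply Rmin_glb_lt; lra).
exists (mkposreal _ He); intros y Hy.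
unfold ball in Hy; simpl in Hy; unfold AbsRing_ball, abs, minus, plus, opp in Hy; simpl in Hy.
apply Rabs_lt_between in Hy.
pose proof (Rmin_l (PI - x) (x + PI)); pose proof (Rmin_r (PI - x) (x + PI)).
apply (@RInt_correct R_CompleteNormedModule), (@ex_RInt_continuous R_CompleteNormedModule).
intros z Hz; apply continuous_tcot.
unfold Rmin, Rmax in Hz; destruct (Rle_dec 0 y) in Hz; lra.
Qed.

Lemma Phi_0 : Phi 0 = 0.
Proof. apply (@RInt_point R_CompleteNormedModule). Qed.

Lemma is_derive_Phi_comp (f : R -> R) (x l : R) :
  - PI < f x < PI -> is_derive f x l -> is_derive (fun t => Phi (f t)) x (l * tcot (f x)).
Proof. intros Hx Hf; apply (is_derive_comp Phi f x); [now apply is_derive_Phi | easy]. Qed.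

Lemma eq_of_is_derive (f g df : R -> R) (a b : R) :
  a <= b ->
  (forall x, a <= x <= b -> is_derive f x (df x)) ->
  (forall x, a <= x <= b -> is_derive g x (df x)) ->
  f b - f a = g b - g a.
Proof.
intros [Hab | ->] Hf Hg; [| ring].
enough (f a - g a = f b - g b) by lra.
apply (@eq_is_derive R_NormedModule (fun x => f x - g x) a b); [| easy].
intros t Ht.
replace (@zero R_NormedModule) with (minus (df t) (df t)) by apply (minus_eq_zero (df t)).
now apply (@is_derive_minus R_AbsRing R_NormedModule); [apply Hf | apply Hg].
Qed.

(** The derivatives agree because cot x - tan x = 2 cot 2x; the logarithm cancels the part of (x +
    pi/2) cot (x + pi/2) that comes from the shift pi/2. *)
Lemma Phi_double (x : R) : 0 <= x < PI / 2 ->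
  Phi (2 * x) = 2 * Phi x + 2 * Phi (x + PI / 2) - 2 * Phi (PI / 2) - PI * ln (cos x).
Proof.
intros Hx; pose proof PI_RGT_0.
enough (E : Phi (2 * x) - Phi (2 * 0) =
  (2 * Phi x + 2 * Phi (x + PI / 2) - PI * ln (cos x))
  - (2 * Phi 0 + 2 * Phi (0 + PI / 2) - PI * ln (cos 0))).
{ rewrite Rmult_0_r, Phi_0, cos_0, ln_1, Rplus_0_l in E; lra. }
apply (eq_of_is_derive (fun x => Phi (2 * x))
  (fun x => 2 * Phi x + 2 * Phi (x + PI / 2) - PI * ln (cos x))
  (fun x => 2 * tcot (2 * x))); [lra | |].
- intros y Hy; apply is_derive_Phi_comp; [lra |]; auto_derive; [easy | ring].
- intros y Hy; assert (0 < cos y) by (apply cos_gt_0; lra).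
  evar_last.
  + apply (@is_derive_minus R_AbsRing R_NormedModule).
    * apply (@is_derive_plus R_AbsRing R_NormedModule);
        apply is_derive_scal; [apply is_derive_Phi; lra |].
      apply is_derive_Phi_comp; [lra |]; auto_derive; [easy | reflexivity].
    * apply is_derive_scal; auto_derive; [easy | reflexivity].
  + change (2 * tcot y + 2 * (1 * tcot (y + PI / 2)) - PI * (1 * - sin y * / cos y) = 2 * tcot (2 * y)).
    rewrite (tcot_neq0 (y + PI / 2)) by lra.
    rewrite cos_plus, sin_plus, cos_PI2, sin_PI2.
    destruct (Req_dec y 0) as [-> | Hy0].
    * replace (2 * 0) with 0 by ring; rewrite tcot_0, sin_0, cos_0; field; lra.
    * rewrite !tcot_neq0, sin_2a, cos_2a by lra.
      assert (0 < sin y) by (apply sin_gt_0; lra).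
      field; repeat split; lra.
Qed.

(** Both sides have derivative pi cot x. They are compared from pi/2, where ln (sin x) = 0, since
    this logarithm diverges at both ends of the interval. *)
Lemma Phi_reflect (x : R) : 0 < x < PI ->
  Phi (PI - x) + Phi x = PI * ln (sin x) + 2 * Phi (PI / 2).
Proof.
intros Hx; pose proof PI_RGT_0.
assert (D1 : forall y, 0 < y < PI ->
  is_derive (fun y => Phi (PI - y) + Phi y) y (PI * (cos y / sin y))).
{ intros y Hy; assert (0 < sin y) by (apply sin_gt_0; lra).
  evar_last.
  - apply (@is_derive_plus R_AbsRing R_NormedModule); [| apply is_derive_Phi; lra].
    apply is_derive_Phi_comp; [lra |]; auto_derive; [easy | reflexivity].
  - change (-1 * tcot (PI - y) + tcot y = PI * (cos y / sin y)).
    rewrite !tcot_neq0 by lra.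
    rewrite sin_PI_x, cos_minus, cos_PI, sin_PI; field; lra. }
assert (D2 : forall y, 0 < y < PI ->
  is_derive (fun y => PI * ln (sin y)) y (PI * (cos y / sin y))).
{ intros y Hy; assert (0 < sin y) by (apply sin_gt_0; lra).
  auto_derive; [easy | field; lra]. }
assert (E0 : ln (sin (PI / 2)) = 0) by (rewrite sin_PI2; apply ln_1).
destruct (Rle_dec x (PI / 2)).
- pose proof (eq_of_is_derive _ _ _ x (PI / 2) r
    (fun y Hy => D1 y ltac:(lra)) (fun y Hy => D2 y ltac:(lra))) as E.
  simpl in E; rewrite E0 in E; replace (PI - PI / 2) with (PI / 2) in E by field; lra.
- pose proof (eq_of_is_derive _ _ _ (PI / 2) x ltac:(lra)
    (fun y Hy => D1 y ltac:(lra)) (fun y Hy => D2 y ltac:(lra))) as E.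
  simpl in E; rewrite E0 in E; replace (PI - PI / 2) with (PI / 2) in E by field; lra.
Qed.

(** Euler's log-sine integral after integration by parts: duplication and reflection at pi/4 form a
    linear system for this value. *)
Lemma Phi_PI2 : Phi (PI / 2) = PI / 2 * ln 2.
Proof.
pose proof PI_RGT_0.
pose proof (Phi_double (PI / 4) ltac:(lra)) as E1.
pose proof (Phi_reflect (PI / 4) ltac:(lra)) as E2.
replace (2 * (PI / 4)) with (PI / 2) in E1 by field.
replace (PI / 4 + PI / 2) with (PI - PI / 4) in E1 by field.
rewrite sin_cos_PI4 in E2.
assert (E3 : ln (cos (PI / 4)) = - (ln 2 / 2)).
{ enough (ln (cos (PI / 4)) + ln (cos (PI / 4)) = - ln 2) by lra.
  assert (0 < cos (PI / 4)) by (apply cos_gt_0; lra).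
  rewrite <- ln_mult, <- ln_Rinv by lra; f_equal.
  rewrite cos_PI4; pose proof (sqrt_sqrt 2 ltac:(lra)) as S2; pose proof sqrt2_neq_0.
  apply Rmult_eq_reg_r with (sqrt 2 * sqrt 2); [| lra].
  rewrite S2 at 2; field; auto. }
rewrite E3 in *; lra.
Qed.

(** Adding duplication at pi/6 to reflection at pi/3 cancels [Phi (PI / 2)] and, as sin (pi/3) = cos
    (pi/6), the logarithms too. *)
Lemma Phi_PI3 : 2 * Phi (PI / 3) - Phi (2 * (PI / 3)) = 2 * Phi (PI / 6).
Proof.
pose proof PI_RGT_0.
pose proof (Phi_double (PI / 6) ltac:(lra)) as E1.
pose proof (Phi_reflect (PI / 3) ltac:(lra)) as E2.
replace (2 * (PI / 6)) with (PI / 3) in E1 by field.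
replace (PI / 6 + PI / 2) with (2 * (PI / 3)) in E1 by field.
replace (PI - PI / 3) with (2 * (PI / 3)) in E2 by field.
rewrite sin_PI3_cos_PI6 in E2; lra.
Qed.

(** * The Bloch-Wigner value *)

Lemma is_RInt_Defs (f : R -> R) (a b l : R) : RInt.is_RInt f a b l -> is_RInt f a b l.
Proof.
intros H; exists (ex_RInt_Reals_0 f a b (ex_intro _ l H)).
rewrite <- RInt_Reals; exact (@is_RInt_unique R_CompleteNormedModule f a b l H).
Qed.

(** With z = e^(i pi/3) this is - arg (1 - s z), the angle at the vertex 1 of the triangle 0, 1, s
    z. *)
Definition bw_angle (s : R) : R := atan (s * sqrt 3 / (2 - s)).

Lemma bw_angle_0 : bw_angle 0 = 0.
Proof. unfold bw_angle, Rdiv; rewrite !Rmult_0_l; exact atan_0. Qed.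

Lemma bw_angle_1 : bw_angle 1 = PI / 3.
Proof.
pose proof PI_RGT_0; unfold bw_angle; rewrite <- (atan_tan (PI / 3)) by lra.
rewrite tan_PI3; f_equal; field.
Qed.

Lemma bw_angle_bound (s : R) : 0 <= s <= 1 -> 0 <= bw_angle s <= PI / 3.
Proof.
intros Hs; pose proof (sqrt_lt_R0 3 ltac:(lra)) as H3.
rewrite <- bw_angle_0, <- bw_angle_1.
assert (mono : forall a b, a <= b <= 1 -> bw_angle a <= bw_angle b).
{ intros a b [[Hab | ->] Hb]; [left | right; easy].
  apply atan_increasing.
  apply Rmult_lt_reg_r with ((2 - a) * (2 - b)); [nra |].
  replace (a * sqrt 3 / (2 - a) * ((2 - a) * (2 - b))) with (a * sqrt 3 * (2 - b)) by (field; lra).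
  replace (b * sqrt 3 / (2 - b) * ((2 - a) * (2 - b))) with (b * sqrt 3 * (2 - a)) by (field; lra).
  nra. }
split; apply mono; lra.
Qed.

(** The factor 1 - s + s^2 is |1 - s z|^2. *)
Definition bw_angle' (s : R) : R := sqrt 3 / (2 * (1 - s + s ^ 2)).

Lemma is_derive_bw_angle (s : R) : s <= 1 -> is_derive bw_angle s (bw_angle' s).
Proof.
intros Hs; pose proof (sqrt_sqrt 3 ltac:(lra)) as H3; unfold bw_angle, bw_angle'.
assert (Hp : 0 < 1 - s + s ^ 2) by nra.
auto_derive; [lra |].
field_simplify_eq; [| repeat split; try lra; nra].
replace (sqrt 3 ^ 3) with (3 * sqrt 3) by (rewrite <- H3 at 1; ring); ring.
Qed.

(** This is phi (cot phi - cot (phi + pi/3)) dphi/ds, with phi cot (phi + pi/3) split as (phi +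
    pi/3) cot (phi + pi/3) - (pi/3) cot (phi + pi/3). Each term then has a primitive in [Phi] or ln
    sin, and the expression stays continuous at s = 0, unlike [bw_angle s / s]. *)
Definition bw_deriv (s : R) : R :=
  bw_angle' s * (tcot (bw_angle s) - tcot (bw_angle s + PI / 3)
    + PI / 3 * (cos (bw_angle s + PI / 3) / sin (bw_angle s + PI / 3))).

Lemma continuous_bw_deriv (s : R) : 0 <= s <= 1 -> continuous bw_deriv s.
Proof.
intros Hs; pose proof (bw_angle_bound s Hs); pose proof PI_RGT_0.
assert (Hc : continuous bw_angle s).
{ apply (@ex_derive_continuous R_AbsRing R_NormedModule).
  exists (bw_angle' s); apply is_derive_bw_angle; lra. }
assert (Hc3 : continuous (fun t => bw_angle t + PI / 3) s)
  by (apply (continuous_plus bw_angle); [easy | apply continuous_const]).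
apply (continuous_mult bw_angle').
{ apply (@ex_derive_continuous R_AbsRing R_NormedModule); unfold bw_angle'; auto_derive; nra. }
apply (continuous_plus (fun s => tcot (bw_angle s) - tcot (bw_angle s + PI / 3))).
- apply (continuous_minus (fun s => tcot (bw_angle s))).
  + apply continuous_comp; [easy | apply continuous_tcot; lra].
  + apply (continuous_comp (fun s => bw_angle s + PI / 3)); [easy | apply continuous_tcot; lra].
- apply (continuous_comp (fun s => bw_angle s + PI / 3) (fun t => PI / 3 * (cos t / sin t))); [easy |].
  apply (@ex_derive_continuous R_AbsRing R_NormedModule); auto_derive.
  apply Rgt_not_eq, sin_gt_0; lra.
Qed.

(* In the triangle with vertices 0, 1 and s z the law of sines gives
   s = sin phi / sin (phi + pi/3), whence ds/s = (cot phi - cot (phi + pi/3)) dphi. *)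
Lemma bw_derivE (s : R) : 0 < s < 1 -> bw_deriv s = bw_angle s / s.
Proof.
intros Hs; pose proof (bw_angle_bound s ltac:(lra)); pose proof PI_RGT_0.
pose proof (sqrt_lt_R0 3 ltac:(lra)) as H3; pose proof (sqrt_sqrt 3 ltac:(lra)) as H3'.
assert (Hcos : 0 < cos (bw_angle s)) by (apply cos_gt_0; lra).
assert (Hsin : sin (bw_angle s) = s * sqrt 3 / (2 - s) * cos (bw_angle s)).
{ rewrite <- (tan_atan (s * sqrt 3 / (2 - s))); fold (bw_angle s).
  unfold tan; field; lra. }
assert (Hpos : 0 < bw_angle s).
{ rewrite <- bw_angle_0; apply atan_increasing; unfold Rdiv; rewrite !Rmult_0_l.
  apply Rmult_lt_0_compat; [nra | apply Rinv_0_lt_compat; lra]. }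
assert (Hp : 0 < 1 - s + s ^ 2) by nra.
unfold bw_deriv; rewrite !tcot_neq0 by lra.
rewrite cos_plus, sin_plus, cos_PI3, sin_PI3, Hsin.
unfold bw_angle'.
set (c := cos (bw_angle s)) in *; set (phi := bw_angle s) in *; set (q := sqrt 3) in *.
(* The two fractions are cot phi and cot (phi + pi/3) as rational functions of s and q; the product
   q * q is kept visible so that it can be replaced by 3. *)
transitivity (q / (2 * (1 - s + s ^ 2)) * phi
  * ((2 - s) / (s * q) - (2 - s - s * (q * q)) / (2 * q))).
- field; repeat split; try lra; try nra.
- rewrite H3'; field; repeat split; lra.
Qed.

Lemma is_BW_PI3 : is_BW (1 / 2, sqrt 3 / 2) (2 * Phi (PI / 6)).
Proof.
pose proof PI_RGT_0; pose proof (sqrt_sqrt 3 ltac:(lra)) as H3.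
exists (- (2 * Phi (PI / 6))); split.
- apply is_RInt_Defs.
  (* Agreement on the open interval suffices, so the value 0 of the quotient at s = 0 does no
     harm. *)
  apply (@is_RInt_ext R_NormedModule (fun s => - bw_deriv s)).
  { rewrite Rmin_left, Rmax_right by lra; intros s Hs; rewrite bw_derivE by easy.
    unfold Carg, Csub, Cof, Cscale, Cre, Cim, bw_angle; simpl.
    destruct (Rlt_dec 0 (1 - s * (1 / 2))); [| lra].
    replace ((0 - s * (sqrt 3 / 2)) / (1 - s * (1 / 2))) with (- (s * sqrt 3 / (2 - s))) by (field; lra).
    rewrite atan_opp; field; lra. }
  apply (@is_RInt_opp R_NormedModule bw_deriv).
  set (F s := Phi (bw_angle s) - (Phi (bw_angle s + PI / 3)
    - PI / 3 * ln (sin (bw_angle s + PI / 3)))).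
  assert (E : minus (F 1) (F 0) = 2 * Phi (PI / 6)).
  { change (F 1 - F 0 = 2 * Phi (PI / 6)); unfold F.
    rewrite bw_angle_0, bw_angle_1, Phi_0, Rplus_0_l.
    replace (PI / 3 + PI / 3) with (2 * (PI / 3)) by ring.
    replace (sin (2 * (PI / 3))) with (sin (PI / 3)); [pose proof Phi_PI3; lra |].
    rewrite <- sin_PI_x; f_equal; field. }
  rewrite <- E; apply (@is_RInt_derive R_CompleteNormedModule);
    rewrite Rmin_left, Rmax_right by lra; intros s Hs;
    [| now apply continuous_bw_deriv].
  pose proof (bw_angle_bound s Hs).
  pose proof (is_derive_bw_angle s ltac:(lra)) as D.
  assert (D3 : is_derive (fun t => bw_angle t + PI / 3) s (bw_angle' s)).
  { evar_last; [apply (@is_derive_plus R_AbsRing R_NormedModule bw_angle); [exact D | apply is_derive_const] |].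
    apply plus_zero_r. }
  unfold F; evar_last.
  + apply (@is_derive_minus R_AbsRing R_NormedModule); [apply is_derive_Phi_comp; [lra | exact D] |].
    apply (@is_derive_minus R_AbsRing R_NormedModule); [apply is_derive_Phi_comp; [lra | exact D3] |].
    apply (is_derive_comp (fun v => PI / 3 * ln (sin v)) (fun t => bw_angle t + PI / 3)); [| exact D3].
    auto_derive; [apply sin_gt_0; lra | reflexivity].
  + change (bw_angle' s * tcot (bw_angle s) - (bw_angle' s * tcot (bw_angle s + PI / 3)
      - bw_angle' s * (PI / 3 * (1 * cos (bw_angle s + PI / 3) * / sin (bw_angle s + PI / 3)))) = bw_deriv s).
    unfold bw_deriv, Rdiv; ring.
- replace (Cnorm (1 / 2, sqrt 3 / 2)) with 1; [rewrite ln_1; ring |].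
  unfold Cnorm, Cre, Cim; simpl.
  transitivity (sqrt 1); [now rewrite sqrt_1 | f_equal; nra].
Qed.

(** * Jensen's formula *)

Lemma ex_RInt_cont (f : R -> R) (a b : R) : (forall x, continuous f x) -> ex_RInt f a b.
Proof. intros H; apply (@ex_RInt_continuous R_CompleteNormedModule); intros; apply H. Qed.

Lemma continuous_of_ex_derive (f : R -> R) (x : R) : ex_derive f x -> continuous f x.
Proof. apply (@ex_derive_continuous R_AbsRing R_NormedModule). Qed.

(** * Integrals over a full period *)

Lemma RInt_translate (f : R -> R) (a b c : R) : (forall x, continuous f x) ->
  RInt (fun s => f (s + c)) a b = RInt f (a + c) (b + c).
Proof.
intros Hf; rewrite (Rplus_comm a), (Rplus_comm b).
pose proof (@RInt_comp_lin R_CompleteNormedModule f 1 c a b (ex_RInt_cont f _ _ Hf)) as E.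
rewrite !Rmult_1_l, !(Rplus_comm _ c) in E; rewrite <- E.
apply (@RInt_ext R_CompleteNormedModule); intros x _.
change (f (x + c) = 1 * f (1 * x + c)); now rewrite !Rmult_1_l.
Qed.

Lemma RInt_period (f : R -> R) (c T : R) :
  (forall x, continuous f x) -> (forall x, f (x + T) = f x) ->
  RInt (fun s => f (s + c)) 0 T = RInt f 0 T.
Proof.
intros Hf HT; rewrite RInt_translate by easy; rewrite Rplus_0_l.
pose proof (RInt_translate f 0 c T Hf) as E.
rewrite (@RInt_ext R_CompleteNormedModule _ f), Rplus_0_l, (Rplus_comm c T) in E by (intros; apply HT).
pose proof (@RInt_Chasles R_CompleteNormedModule f 0 c (T + c)
  (ex_RInt_cont f _ _ Hf) (ex_RInt_cont f _ _ Hf)) as E1.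
pose proof (@RInt_Chasles R_CompleteNormedModule f 0 T (T + c)
  (ex_RInt_cont f _ _ Hf) (ex_RInt_cont f _ _ Hf)) as E2.
change (RInt f 0 c + RInt f c (T + c) = RInt f 0 (T + c)) in E1.
change (RInt f 0 T + RInt f T (T + c) = RInt f 0 (T + c)) in E2.
change (RInt f 0 c = RInt f T (T + c)) in E.
lra.
Qed.

Lemma RInt_period_double (f : R -> R) (T : R) :
  (forall x, continuous f x) -> (forall x, f (x + T) = f x) ->
  RInt (fun s => f (2 * s)) 0 T = RInt f 0 T.
Proof.
intros Hf HT.
pose proof (@RInt_comp_lin R_CompleteNormedModule f 2 0 0 T (ex_RInt_cont f _ _ Hf)) as E.
rewrite Rmult_0_r, !Rplus_0_r in E.
rewrite (@RInt_ext R_CompleteNormedModule _ (fun y => scal 2 (f (2 * y)))) in E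
  by (intros; now rewrite Rplus_0_r).
rewrite (@RInt_scal R_CompleteNormedModule (fun y => f (2 * y))) in E.
2:{ apply ex_RInt_cont; intros x.
    apply (continuous_comp (fun y => 2 * y)); [| apply Hf].
    apply continuous_of_ex_derive; now auto_derive. }
pose proof (@RInt_Chasles R_CompleteNormedModule f 0 T (T + T)
  (ex_RInt_cont f _ _ Hf) (ex_RInt_cont f _ _ Hf)) as E1.
change (RInt f 0 T + RInt f T (T + T) = RInt f 0 (T + T)) in E1.
pose proof (RInt_period f T T Hf HT) as E2.
rewrite RInt_translate, Rplus_0_l in E2 by easy.
change (2 * RInt (fun y => f (2 * y)) 0 T = RInt f 0 (2 * T)) in E.
replace (2 * T) with (T + T) in E by ring; lra.
Qed.

(** Equals |1 - r e^(is)|^2, the denominator of the Poisson kernel. *)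
Definition poisson (r s : R) : R := 1 - 2 * r * cos s + r ^ 2.

Lemma poisson_ge (r x s : R) : Rabs x <= r -> r < 1 -> (1 - r) ^ 2 <= poisson x s.
Proof.
intros Hx Hr; apply Rabs_le_between in Hx; pose proof (COS_bound s); unfold poisson.
destruct (Rle_dec 0 x); nra.
Qed.

Lemma poisson_le (x s : R) : Rabs x < 1 -> poisson x s <= 4.
Proof.
intros Hx; apply Rabs_lt_between in Hx; pose proof (COS_bound s); unfold poisson; nra.
Qed.

Lemma poisson_pos (x s : R) : Rabs x < 1 -> 0 < poisson x s.
Proof. intros Hx; pose proof (poisson_ge (Rabs x) x s (Rle_refl _) Hx); nra. Qed.

Lemma continuous_ln_poisson (r s : R) : Rabs r < 1 -> continuous (fun s => ln (poisson r s)) s.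
Proof.
intros Hr; apply continuous_of_ex_derive.
pose proof (poisson_pos r s Hr); unfold poisson in *; auto_derive; lra.
Qed.

Lemma cos_period1 (x : R) : cos (x + 2 * PI) = cos x.
Proof. rewrite <- (cos_period x 1); f_equal; simpl; ring. Qed.

Definition poisson_int (r : R) : R := RInt (fun s => ln (poisson r s)) 0 (2 * PI).

(* The product of poisson r s and poisson (-r) s is poisson (r^2) (2s). *)
Lemma poisson_int_sqr (r : R) : Rabs r < 1 -> poisson_int r = poisson_int (r ^ 2) / 2.
Proof.
intros Hr.
assert (Hr' : Rabs (- r) < 1) by now rewrite Rabs_Ropp.
assert (Hr2 : Rabs (r ^ 2) < 1).
{ rewrite <- RPow_abs; pose proof (Rabs_pos r); nra. }
assert (E1 : RInt (fun s => ln (poisson (- r) s)) 0 (2 * PI) = poisson_int r).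
{ unfold poisson_int; rewrite <- (RInt_period _ PI).
  - apply (@RInt_ext R_CompleteNormedModule); intros s _.
    unfold poisson; rewrite neg_cos; f_equal; ring.
  - intros; now apply continuous_ln_poisson.
  - intros x; unfold poisson; now rewrite cos_period1. }
assert (E2 : poisson_int (r ^ 2) = poisson_int r + RInt (fun s => ln (poisson (- r) s)) 0 (2 * PI)).
{ unfold poisson_int; rewrite <- (RInt_period_double (fun s => ln (poisson (r ^ 2) s))).
  - rewrite <- (@RInt_plus R_CompleteNormedModule (fun s => ln (poisson r s)))
      by (apply ex_RInt_cont; intros; now apply continuous_ln_poisson).
    apply (@RInt_ext R_CompleteNormedModule); intros s _.
    change (ln (poisson (r ^ 2) (2 * s)) = ln (poisson r s) + ln (poisson (- r) s)).
    rewrite <- ln_mult by now apply poisson_pos.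
    f_equal; unfold poisson; rewrite cos_2a_cos; ring.
  - intros; now apply continuous_ln_poisson.
  - intros x; unfold poisson; now rewrite cos_period1. }
lra.
Qed.

(* Iterating [poisson_int_sqr] n times gains a factor 2^-n over a bound valid on |x| <= |r|. *)
Lemma poisson_int_0 (r : R) : Rabs r < 1 -> poisson_int r = 0.
Proof.
intros Hr; pose proof PI_RGT_0.
(* On the interval |x| <= |r| the values of [poisson] lie between (1 - |r|)^2 and 4, and squaring
   preserves this interval, so one bound serves every iterate. *)
set (M := ln 4 + Rabs (ln ((1 - Rabs r) ^ 2))).
assert (H4 : 0 < ln 4) by (rewrite <- ln_1; apply ln_increasing; lra).
assert (HM : 0 < M) by (pose proof (Rabs_pos (ln ((1 - Rabs r) ^ 2))); unfold M; lra).
assert (Hbound : forall n x, Rabs x <= Rabs r -> Rabs (poisson_int x) <= 2 * PI * M * (1 / 2) ^ n).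
{ induction n as [| n IHn]; intros x Hx; assert (Hx1 : Rabs x < 1) by lra.
  - rewrite pow_O, Rmult_1_r; replace (2 * PI * M) with ((2 * PI - 0) * M) by ring.
    apply abs_RInt_le_const; [lra | apply ex_RInt_cont; intros; now apply continuous_ln_poisson |].
    intros s _; pose proof (poisson_ge (Rabs r) x s Hx Hr) as Hge.
    pose proof (poisson_le x s Hx1).
    pose proof (ln_le _ _ (pow_lt _ 2 (proj2 (Rlt_0_minus _ _) Hr)) Hge) as Hl.
    pose proof (Rle_abs (- ln ((1 - Rabs r) ^ 2))) as Ha; rewrite Rabs_Ropp in Ha.
    assert (ln (poisson x s) <= ln 4) by (apply ln_le; [now apply poisson_pos | easy]).
    pose proof (Rabs_pos (ln ((1 - Rabs r) ^ 2))).
    apply Rabs_le; unfold M; lra.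
  - rewrite poisson_int_sqr by easy; unfold Rdiv at 1; rewrite Rabs_mult, (Rabs_pos_eq (/ 2)) by lra.
    assert (Hx2 : Rabs (x ^ 2) <= Rabs r).
    { rewrite <- RPow_abs; pose proof (Rabs_pos x); nra. }
    specialize (IHn _ Hx2).
    change ((1 / 2) ^ S n) with (1 / 2 * (1 / 2) ^ n); lra. }
destruct (Req_dec (poisson_int r) 0) as [| Hne]; [easy |].
apply Rabs_pos_lt in Hne.
assert (HC : 0 < 2 * PI * M) by (apply Rmult_lt_0_compat; lra).
destruct (pow_lt_1_zero (1 / 2) ltac:(apply Rabs_def1; lra)
  (Rabs (poisson_int r) / (2 * PI * M))) as [N HN].
{ now apply Rdiv_lt_0_compat. }
specialize (HN N (le_n N)); specialize (Hbound N r (Rle_refl _)).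
rewrite Rabs_pos_eq in HN by (apply pow_le; lra).
apply (Rmult_lt_compat_l (2 * PI * M)) in HN; [| easy].
replace (2 * PI * M * (Rabs (poisson_int r) / (2 * PI * M))) with (Rabs (poisson_int r)) in HN
  by (field; split; lra).
lra.
Qed.

Lemma sub_mult_cos_pos (A B s : R) : Rabs B < A -> 0 < A - B * cos s.
Proof.
intros HB; pose proof (Rle_abs (B * cos s)) as H; rewrite Rabs_mult in H.
assert (Rabs (cos s) <= 1) by (apply Rabs_le, COS_bound).
pose proof (Rabs_pos B); nra.
Qed.

(** For 0 < |B| < A this is |B|/2 times the modulus of the larger root of B z^2 - 2 A z + B. It
    remains meaningful at A = |B|, which the limiting arguments use. *)
Definition jensen (A B : R) : R := (A + sqrt (A ^ 2 - B ^ 2)) / 2.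

Lemma RInt_ln_cos (A B p : R) : Rabs B < A ->
  RInt (fun s => ln (A - B * cos (s + p))) 0 (2 * PI) = 2 * PI * ln (jensen A B).
Proof.
intros HAB; pose proof (Rabs_pos B) as HB0.
assert (HB : - A < B < A) by now apply Rabs_lt_between.
assert (Hcont : forall s, continuous (fun s => ln (A - B * cos s)) s).
{ intros s; apply continuous_of_ex_derive; auto_derive; now apply sub_mult_cos_pos. }
rewrite (RInt_period (fun s => ln (A - B * cos s))); [| easy | intros; now rewrite cos_period1].
assert (HS : 0 < A ^ 2 - B ^ 2) by nra.
pose proof (sqrt_lt_R0 _ HS) as HR; pose proof (sqrt_sqrt _ (Rlt_le _ _ HS)) as HR2.
unfold jensen; set (q := sqrt (A ^ 2 - B ^ 2)) in *.
(* These values solve k (1 + r^2) = A and 2 k r = B, so that A - B cos s = k * [poisson r s]. *)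
set (k := (A + q) / 2); set (r := B / (A + q)).
assert (Hk : 0 < k) by (unfold k; lra).
assert (Hr : Rabs r < 1).
{ unfold r, Rdiv; rewrite Rabs_mult, (Rabs_pos_eq (/ (A + q)))
    by (left; apply Rinv_0_lt_compat; lra).
  apply Rmult_lt_reg_r with (A + q); [lra |]; field_simplify; lra. }
rewrite (@RInt_ext R_CompleteNormedModule _ (fun s => plus (ln k) (ln (poisson r s)))).
- rewrite (@RInt_plus R_CompleteNormedModule), (@RInt_const R_CompleteNormedModule).
  + change ((2 * PI - 0) * ln k + poisson_int r = 2 * PI * ln k).
    rewrite poisson_int_0 by easy; ring.
  + apply ex_RInt_cont; intros; apply continuous_const.
  + apply ex_RInt_cont; intros; now apply continuous_ln_poisson.
- intros s _; change (ln (A - B * cos s) = ln k + ln (poisson r s)).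
  rewrite <- ln_mult by (try apply poisson_pos; easy).
  f_equal; unfold poisson, k, r; field_simplify_eq; [| lra].
  replace (B ^ 2) with (A ^ 2 - q * q) by lra; ring.
Qed.

(** * The deformation of the weights *)

(* Integrating ln p_e over t gives [2 * PI * kint e x]: with A = 4 sin^2(x/2) + 4e and
   B = 4e cos(x/2), [sqrt (A^2 - B^2)] is [4 * sin (x / 2) * sqrt (rad e x)] and
   [jensen A B] is [2 * karg e x]. *)
Definition rad (e x : R) : R := sin (x / 2) ^ 2 + 2 * e + e ^ 2.
Definition karg (e x : R) : R := sin (x / 2) ^ 2 + e + sin (x / 2) * sqrt (rad e x).
Definition kint (e x : R) : R := ln (2 * karg e x).
Definition kder (e x : R) : R := / e * (1 - sin (x / 2) / sqrt (rad e x)).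
Definition K (e : R) : R := RInt (kint e) 0 (2 * PI).

Lemma rad_pos (e x : R) : 0 < e -> 0 < rad e x.
Proof. intros He; unfold rad; pose proof (pow2_ge_0 (sin (x / 2))); nra. Qed.

Lemma sin_half_ge_0 (x : R) : 0 <= x <= 2 * PI -> 0 <= sin (x / 2).
Proof. intros Hx; apply sin_ge_0; lra. Qed.

(** Doubled, the lower bound reads 2 + 2e - 2 cos x, an integrand that Jensen's formula covers. *)
Lemma karg_ge (e x : R) : 0 < e -> 0 <= x <= 2 * PI -> 2 * sin (x / 2) ^ 2 + e <= karg e x.
Proof.
intros He Hx; pose proof (sin_half_ge_0 x Hx) as Hs; unfold karg.
assert (sin (x / 2) <= sqrt (rad e x)).
{ rewrite <- (sqrt_pow2 (sin (x / 2))) at 1 by easy; apply sqrt_le_1_alt; unfold rad; nra. }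
nra.
Qed.

Lemma karg_pos (e x : R) : 0 < e -> 0 <= x <= 2 * PI -> 0 < karg e x.
Proof. intros He Hx; pose proof (karg_ge e x He Hx); pose proof (pow2_ge_0 (sin (x / 2))); lra. Qed.

(** The inequality 2 s q <= s^2 + q^2 removes the square root; doubled, the bound becomes 2 + 4e +
    e^2 - 2 cos x. *)
Lemma karg_le (e x : R) : 0 < e -> karg e x <= 2 * sin (x / 2) ^ 2 + 2 * e + e ^ 2 / 2.
Proof.
intros He; unfold karg; pose proof (sqrt_sqrt _ (Rlt_le _ _ (rad_pos e x He))) as HR.
set (q := sqrt (rad e x)) in *; unfold rad in HR.
pose proof (pow2_ge_0 (sin (x / 2) - q)); nra.
Qed.

Lemma is_derive_kint (e x : R) : 0 < e -> 0 < karg e x -> is_derive (fun e => kint e x) e (kder e x).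
Proof.
intros He Ha; pose proof (rad_pos e x He) as Hr.
pose proof (sqrt_lt_R0 _ Hr) as HR; pose proof (sqrt_sqrt _ (Rlt_le _ _ Hr)) as HR2.
unfold kint, kder, karg, rad in *; simpl pow in *; auto_derive.
- repeat split; lra.
- set (s := sin (x / 2)) in *.
  set (q := sqrt (s * (s * 1) + 2 * e + e * (e * 1))) in *.
  field_simplify_eq; [| repeat split; nra].
  replace (q ^ 2) with (s ^ 2 + 2 * e + e ^ 2) by lra; ring.
Qed.

(** * Joint continuity and differentiation under the integral *)

Lemma continuity_pt_of_ex_derive (f : R -> R) (x : R) : ex_derive f x -> continuity_pt f x.
Proof. intros Hf; apply continuity_pt_filterlim; exact (continuous_of_ex_derive f x Hf). Qed.

Lemma continuity_2d_pt_sin_half (e x : R) : continuity_2d_pt (fun _ v => sin (v / 2)) e x.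
Proof.
apply (continuity_1d_2d_pt_comp (fun v => sin (v / 2)) (fun _ v => v));
  [| apply continuity_2d_pt_id2].
apply continuity_pt_of_ex_derive; now auto_derive.
Qed.

Lemma continuity_2d_pt_rad (e x : R) : continuity_2d_pt rad e x.
Proof.
unfold rad; apply continuity_2d_pt_plus; [apply continuity_2d_pt_plus |].
- apply (continuity_1d_2d_pt_comp (fun v => v ^ 2) (fun _ v => sin (v / 2)));
    [| apply continuity_2d_pt_sin_half].
  apply continuity_pt_of_ex_derive; now auto_derive.
- apply continuity_2d_pt_mult; [apply continuity_2d_pt_const | apply continuity_2d_pt_id1].
- apply (continuity_1d_2d_pt_comp (fun v => v ^ 2) (fun u _ => u)); [| apply continuity_2d_pt_id1].
  apply continuity_pt_of_ex_derive; now auto_derive.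
Qed.

Lemma continuity_2d_pt_sqrt_rad (e x : R) : continuity_2d_pt (fun u v => sqrt (rad u v)) e x.
Proof.
apply continuity_1d_2d_pt_comp; [| apply continuity_2d_pt_rad].
apply continuity_pt_filterlim, continuous_sqrt.
Qed.

Lemma continuity_2d_pt_karg (e x : R) : continuity_2d_pt karg e x.
Proof.
unfold karg; apply continuity_2d_pt_plus; [apply continuity_2d_pt_plus |].
- apply (continuity_1d_2d_pt_comp (fun v => v ^ 2) (fun _ v => sin (v / 2)));
    [| apply continuity_2d_pt_sin_half].
  apply continuity_pt_of_ex_derive; now auto_derive.
- apply continuity_2d_pt_id1.
- apply continuity_2d_pt_mult; [apply continuity_2d_pt_sin_half | apply continuity_2d_pt_sqrt_rad].
Qed.

Lemma continuity_2d_pt_kder (e x : R) : 0 < e -> continuity_2d_pt kder e x.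
Proof.
intros He; pose proof (sqrt_lt_R0 _ (rad_pos e x He)).
unfold kder; apply continuity_2d_pt_mult.
- apply continuity_2d_pt_inv; [apply continuity_2d_pt_id1 | lra].
- apply continuity_2d_pt_minus; [apply continuity_2d_pt_const |].
  apply continuity_2d_pt_mult; [apply continuity_2d_pt_sin_half |].
  apply continuity_2d_pt_inv; [apply continuity_2d_pt_sqrt_rad | lra].
Qed.

Lemma continuity_2d_pt_locally_pos (f : R -> R -> R) (x y : R) :
  continuity_2d_pt f x y -> 0 < f x y -> locally_2d (fun u v => 0 < f u v) x y.
Proof.
intros Hf Hp; generalize (Hf (mkposreal _ Hp)); apply locally_2d_impl.
apply locally_2d_forall; intros u v Huv; simpl in Huv.
apply Rabs_lt_between in Huv; lra.
Qed.

Lemma continuous_of_2d (f : R -> R -> R) (x y : R) :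
  continuity_2d_pt f x y -> continuous (f x) y.
Proof.
intros Hf; apply continuity_pt_filterlim; intros eps Heps.
destruct (Hf (mkposreal _ Heps)) as [del Hdel]; exists del; split; [apply cond_pos |].
intros v [_ Hv]; apply (Hdel x v); [| easy].
rewrite Rminus_diag, Rabs_R0; apply cond_pos.
Qed.

Lemma continuity_2d_pt_kint (e x : R) : 0 < karg e x -> continuity_2d_pt kint e x.
Proof.
intros Ha; apply (continuity_1d_2d_pt_comp (fun v => ln (2 * v)) karg); [| apply continuity_2d_pt_karg].
apply continuity_pt_of_ex_derive; auto_derive; lra.
Qed.

Lemma ex_RInt_kint (e : R) : 0 < e -> ex_RInt (kint e) 0 (2 * PI).
Proof.
intros He; pose proof PI_RGT_0; apply (@ex_RInt_continuous R_CompleteNormedModule).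
rewrite Rmin_left, Rmax_right by lra; intros x Hx.
now apply continuous_of_2d, continuity_2d_pt_kint, karg_pos.
Qed.

Lemma locally_pos (e : R) : 0 < e -> locally e (fun u => 0 < u).
Proof. intros He; apply (open_gt 0 e He). Qed.

Lemma is_derive_K (e : R) : 0 < e -> is_derive K e (RInt (kder e) 0 (2 * PI)).
Proof.
intros He; pose proof PI_RGT_0.
rewrite (@RInt_ext R_CompleteNormedModule _ (fun t => Derive (fun u => kint u t) e)).
- apply (is_derive_RInt_param kint); rewrite ?Rmin_left, ?Rmax_right by lra.
  + generalize (locally_pos e He); apply filter_imp; intros u Hu x Hx.
    exists (kder u x); now apply is_derive_kint, karg_pos.
  + intros x Hx; apply continuity_2d_pt_ext_loc with kder; [| now apply continuity_2d_pt_kder].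
    (* Points near (e, x) may have their second coordinate outside [0, 2 pi], where sin (v/2) can be
       negative; positivity of [karg] there comes from continuity. *)
    assert (H1 := continuity_2d_pt_locally_pos _ _ _ (continuity_2d_pt_karg e x) (karg_pos e x He Hx)).
    assert (H2 := continuity_2d_pt_locally_pos (fun u _ => u) e x (continuity_2d_pt_id1 e x) He).
    generalize (locally_2d_and _ _ _ _ H1 H2); apply locally_2d_impl.
    apply locally_2d_forall; intros u v [Ha Hu]; symmetry.
    now apply is_derive_unique, is_derive_kint.
  + generalize (locally_pos e He); apply filter_imp; intros u Hu; now apply ex_RInt_kint.
- rewrite Rmin_left, Rmax_right by lra; intros x Hx; symmetry.
  apply is_derive_unique, is_derive_kint; [easy | apply karg_pos; lra].
Qed.

(** Since [rad e x] = (1 + e)^2 - cos^2(x/2), the arctangent is arcsin (cos (x/2) / (1 + e)). *)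
Lemma is_derive_kder_primitive (e x : R) : 0 < e ->
  is_derive (fun x => / e * (x + 2 * atan (cos (x / 2) / sqrt (rad e x)))) x (kder e x).
Proof.
intros He; pose proof (rad_pos e x He) as Hr.
pose proof (sqrt_lt_R0 _ Hr) as HR; pose proof (sqrt_sqrt _ (Rlt_le _ _ Hr)) as HR2.
pose proof (sin2_cos2 (x / 2)) as SC; unfold Rsqr in SC.
unfold kder, rad in *; simpl pow in *; auto_derive.
- repeat split; lra.
- change (x * / 2) with (x / 2).
  set (s := sin (x / 2)) in *; set (c := cos (x / 2)) in *.
  set (q := sqrt (s * (s * 1) + 2 * e + e * (e * 1))) in *.
  field; repeat split; nra.
Qed.

Lemma inv_cos_sub_1_pos (b : R) : 0 < b < PI / 2 -> 0 < / cos b - 1.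
Proof.
intros Hb; assert (Hc : 0 < cos b) by (apply cos_gt_0; lra).
assert (Hc1 : cos b < 1) by (rewrite <- cos_0; apply cos_decreasing_1; lra).
enough (/ 1 < / cos b) by lra; apply Rinv_lt_contravar; lra.
Qed.

Lemma RInt_kder (b : R) : 0 < b < PI / 2 ->
  RInt (kder (/ cos b - 1)) 0 (2 * PI) = 4 * b / (/ cos b - 1).
Proof.
intros Hb; pose proof PI_RGT_0.
assert (Hc : 0 < cos b) by (apply cos_gt_0; lra).
assert (Hs : 0 < sin b) by (apply sin_gt_0; lra).
pose proof (inv_cos_sub_1_pos b Hb) as He.
set (e := / cos b - 1) in *.
apply (@is_RInt_unique R_CompleteNormedModule).
set (F := fun x => / e * (x + 2 * atan (cos (x / 2) / sqrt (rad e x)))).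
(* At both endpoints [rad] reduces to (1 + e)^2 - 1 = 1/cos^2 b - 1 = tan^2 b. *)
assert (Erad : forall x, sin (x / 2) = 0 -> sqrt (rad e x) = tan b).
{ intros x Hx; unfold rad; rewrite Hx.
  transitivity (sqrt (tan b ^ 2)); [f_equal | apply sqrt_pow2; left; apply tan_gt_0; lra].
  unfold e, tan; pose proof (sin2_cos2 b) as SC; unfold Rsqr in SC.
  field_simplify_eq; [| lra]; nra. }
assert (Ecot : atan (/ tan b) = PI / 2 - b) by (rewrite atan_inv by (apply tan_gt_0; lra);
  rewrite atan_tan; lra).
assert (E : minus (F (2 * PI)) (F 0) = 4 * b / e).
{ change (F (2 * PI) - F 0 = 4 * b / e); unfold F.
  replace (2 * PI / 2) with PI by field; replace (0 / 2) with 0 by field.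
  rewrite !Erad by (replace (2 * PI / 2) with PI by field; replace (0 / 2) with 0 by field;
    apply sin_PI || apply sin_0).
  rewrite cos_PI, cos_0.
  replace (-1 / tan b) with (- / tan b) by (unfold Rdiv; ring).
  replace (1 / tan b) with (/ tan b) by (unfold Rdiv; ring).
  rewrite atan_opp, Ecot; field; lra. }
rewrite <- E; apply (@is_RInt_derive R_CompleteNormedModule); intros x _.
- now apply is_derive_kder_primitive.
- now apply continuous_of_2d, continuity_2d_pt_kder.
Qed.

(* The primitive of 4 b (cot (b/2) + tan b) vanishing at 0. *)
Definition Kval (b : R) : R :=
  4 * (4 * Phi (b / 2) + Phi (PI / 2 - b) - PI / 2 * ln (cos b) - Phi (PI / 2)).

(** Four times [Phi (PI / 2 - b)] contributes 4 (b - pi/2) tan b, and the logarithm supplies the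
    missing 2 pi tan b. *)
Lemma is_derive_Kval (b : R) : 0 < b < PI / 2 ->
  is_derive Kval b (4 * b * (cos (b / 2) / sin (b / 2) + sin b / cos b)).
Proof.
intros Hb; pose proof PI_RGT_0.
assert (Hc : 0 < cos b) by (apply cos_gt_0; lra).
assert (Hs : 0 < sin (b / 2)) by (apply sin_gt_0; lra).
unfold Kval; apply is_derive_Reals; evar_last.
- apply is_derive_Reals, is_derive_scal.
  apply (@is_derive_minus R_AbsRing R_NormedModule); [| apply is_derive_const].
  apply (@is_derive_minus R_AbsRing R_NormedModule).
  + apply (@is_derive_plus R_AbsRing R_NormedModule).
    * apply is_derive_scal, is_derive_Phi_comp; [lra |].
      auto_derive; [easy | reflexivity].
    * apply is_derive_Phi_comp; [lra |].
      auto_derive; [easy | reflexivity].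
  + auto_derive; [easy | reflexivity].
- change (4 * (4 * (1 * / 2 * tcot (b / 2)) + -1 * tcot (PI / 2 + - b)
    - PI * / 2 * (1 * - sin b * / cos b) - 0)
    = 4 * b * (cos (b / 2) / sin (b / 2) + sin b / cos b)).
  rewrite !tcot_neq0 by lra; change (PI / 2 + - b) with (PI / 2 - b).
  rewrite cos_shift, sin_shift.
  field; lra.
Qed.

(** The chain rule gives 4 b sin b / (cos b (1 - cos b)), which splits into partial fractions by cot
    (b/2) = sin b / (1 - cos b). *)
Lemma is_derive_K_comp (b : R) : 0 < b < PI / 2 ->
  is_derive (fun b => K (/ cos b - 1)) b (4 * b * (cos (b / 2) / sin (b / 2) + sin b / cos b)).
Proof.
intros Hb; pose proof PI_RGT_0.
assert (Hc : 0 < cos b) by (apply cos_gt_0; lra).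
assert (Hs : 0 < sin (b / 2)) by (apply sin_gt_0; lra).
assert (Hc2 : 0 < cos (b / 2)) by (apply cos_gt_0; lra).
pose proof (inv_cos_sub_1_pos b Hb) as He.
evar_last.
- apply (is_derive_comp K (fun b => / cos b - 1)); [now apply is_derive_K |].
  auto_derive; [lra | reflexivity].
- rewrite RInt_kder by easy.
  replace (sin b) with (2 * sin (b / 2) * cos (b / 2)) by (rewrite <- sin_2a; f_equal; field).
  pose proof (cos_2a_sin (b / 2)) as E; replace (2 * (b / 2)) with b in E by field.
  pose proof (sin2_cos2 (b / 2)) as SC; unfold Rsqr in SC.
  set (s := sin (b / 2)) in *; set (c := cos (b / 2)) in *.
  rewrite E in *; unfold scal; simpl; unfold mult; simpl.
  field; repeat split; nra.
Qed.

(** * The limit of K(e) at 0 and the value K(1) *)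

Lemma RInt_ln_minus_2cos (A : R) : 2 < A ->
  RInt.is_RInt (fun x => ln (A - 2 * cos x)) 0 (2 * PI) (2 * PI * ln (jensen A 2)).
Proof.
intros HA; assert (H2 : Rabs 2 < A) by (rewrite Rabs_pos_eq; lra).
rewrite <- (RInt_ln_cos A 2 0 H2).
rewrite (@RInt_ext R_CompleteNormedModule _ (fun x => ln (A - 2 * cos x)))
  by (intros; now rewrite Rplus_0_r).
apply (@RInt_correct R_CompleteNormedModule), ex_RInt_cont; intros x.
apply continuous_of_ex_derive; auto_derive; now apply sub_mult_cos_pos.
Qed.

Lemma cos_half_sin (x : R) : 2 - 2 * cos x = 4 * sin (x / 2) ^ 2.
Proof.
pose proof (cos_2a_sin (x / 2)) as E; replace (2 * (x / 2)) with x in E by field; rewrite E; ring.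
Qed.

Lemma K_ge_0 (e : R) : 0 < e -> 0 <= K e.
Proof.
intros He; pose proof PI_RGT_0.
apply Rle_trans with (2 * PI * ln (jensen (2 + 2 * e) 2)).
- apply Rmult_le_pos; [lra |]; rewrite <- ln_1; apply ln_le; [lra |].
  unfold jensen; pose proof (sqrt_pos ((2 + 2 * e) ^ 2 - 2 ^ 2)); lra.
- apply (is_RInt_le (fun x => ln (2 + 2 * e - 2 * cos x)) (kint e) 0 (2 * PI)); [lra | | |].
  + apply RInt_ln_minus_2cos; lra.
  + now apply (@RInt_correct R_CompleteNormedModule), ex_RInt_kint.
  + intros x Hx; pose proof (karg_ge e x He ltac:(lra)); pose proof (cos_half_sin x).
    pose proof (pow2_ge_0 (sin (x / 2))).
    apply ln_le; lra.
Qed.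

Lemma ln_le_minus_1 (x : R) : 0 < x -> ln x <= x - 1.
Proof. intros Hx; pose proof (exp_ineq1_le (ln x)) as E; rewrite exp_ln in E by easy; lra. Qed.

Lemma jensen_pos (A B : R) : 0 < A -> 0 < jensen A B.
Proof. intros HA; unfold jensen; pose proof (sqrt_pos (A ^ 2 - B ^ 2)); lra. Qed.

Lemma K_le (e : R) : 0 < e -> K e <= 2 * PI * (jensen (2 + 4 * e + e ^ 2) 2 - 1).
Proof.
intros He; pose proof PI_RGT_0.
apply Rle_trans with (2 * PI * ln (jensen (2 + 4 * e + e ^ 2) 2)).
- apply (is_RInt_le (kint e) (fun x => ln (2 + 4 * e + e ^ 2 - 2 * cos x)) 0 (2 * PI)); [lra | | |].
  + now apply (@RInt_correct R_CompleteNormedModule), ex_RInt_kint.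
  + apply RInt_ln_minus_2cos; nra.
  + intros x Hx; pose proof (karg_le e x He); pose proof (cos_half_sin x).
    pose proof (karg_pos e x He ltac:(lra)).
    apply ln_le; lra.
- apply Rmult_le_compat_l; [lra |]; apply ln_le_minus_1, jensen_pos; nra.
Qed.

Lemma le_of_continuous_right (f : R -> R) (c d : R) : 0 < d ->
  continuous f 0 -> (forall x, 0 < x < d -> c <= f x) -> c <= f 0.
Proof.
intros Hd Hf Hle; apply Rnot_lt_le; intros Hlt.
apply continuity_pt_filterlim in Hf.
destruct (Hf (c - f 0) ltac:(lra)) as [del [Hdel Hb]].
set (x := Rmin del d / 2).
pose proof (Rmin_l del d); pose proof (Rmin_r del d); pose proof (Rmin_glb_lt del d 0 Hdel Hd).
assert (Hx : 0 < x < d) by (unfold x; lra).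
assert (Hx' : Rabs (f x - f 0) < c - f 0).
{ apply Hb; split; [split; [easy | lra] |].
  simpl; unfold Rdist; rewrite Rminus_0_r, Rabs_pos_eq; unfold x; lra. }
specialize (Hle x Hx); apply Rabs_lt_between in Hx'; lra.
Qed.

Lemma continuous_Kval_0 : continuous Kval 0.
Proof.
pose proof PI_RGT_0; unfold Kval.
assert (Hc : forall x, - PI < x < PI -> continuous Phi x).
{ intros x Hx; apply continuous_of_ex_derive; exists (tcot x); now apply is_derive_Phi. }
assert (Hc1 : continuous (fun b => Phi (b / 2)) 0).
{ apply (continuous_comp (fun b => b / 2) Phi); [apply continuous_of_ex_derive; now auto_derive |].
  apply Hc; lra. }
assert (Hc2 : continuous (fun b => Phi (PI / 2 - b)) 0).
{ apply (continuous_comp (fun b => PI / 2 - b) Phi); [apply continuous_of_ex_derive; now auto_derive |].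
  apply Hc; lra. }
assert (Hc3 : continuous (fun b => PI / 2 * ln (cos b)) 0).
{ apply continuous_of_ex_derive; auto_derive; rewrite cos_0; lra. }
apply (continuous_mult (fun _ => 4)); [apply continuous_const |].
apply (continuous_minus (fun b => 4 * Phi (b / 2) + Phi (PI / 2 - b) - PI / 2 * ln (cos b)));
  [| apply continuous_const].
apply (continuous_minus (fun b => 4 * Phi (b / 2) + Phi (PI / 2 - b))); [| easy].
apply (continuous_plus (fun b => 4 * Phi (b / 2))); [| easy].
now apply (continuous_mult (fun _ => 4)); [apply continuous_const |].
Qed.

Lemma Kval_0 : Kval 0 = 0.
Proof.
unfold Kval; replace (0 / 2) with 0 by field; rewrite Phi_0, Rminus_0_r, cos_0, ln_1; ring.
Qed.

Lemma K_eq (b : R) : 0 < b < PI / 2 -> K (/ cos b - 1) = Kval b.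
Proof.
intros Hb.
assert (Hconst : forall x, 0 < x < PI / 2 ->
  K (/ cos b - 1) - Kval b = K (/ cos x - 1) - Kval x).
{ intros x Hx; destruct (Rle_dec x b).
  - pose proof (eq_of_is_derive _ _ _ x b ltac:(lra)
      (fun y Hy => is_derive_K_comp y ltac:(lra)) (fun y Hy => is_derive_Kval y ltac:(lra))) as E.
    simpl in E; lra.
  - pose proof (eq_of_is_derive _ _ _ b x ltac:(lra)
      (fun y Hy => is_derive_K_comp y ltac:(lra)) (fun y Hy => is_derive_Kval y ltac:(lra))) as E.
    simpl in E; lra. }
set (c := K (/ cos b - 1) - Kval b) in *.
assert (H1 : c <= 0).
{ set (f := fun x => 2 * PI * (jensen (2 + 4 * (/ cos x - 1) + (/ cos x - 1) ^ 2) 2 - 1) - Kval x).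
  assert (Hf0 : f 0 = 0).
  { unfold f, jensen; rewrite Kval_0, cos_0.
    replace ((2 + 4 * (/ 1 - 1) + (/ 1 - 1) ^ 2) ^ 2 - 2 ^ 2) with 0 by field.
    rewrite sqrt_0; field. }
  rewrite <- Hf0; apply le_of_continuous_right with (PI / 2); [lra | |].
  - apply (continuous_minus (fun x => 2 * PI * (jensen (2 + 4 * (/ cos x - 1) + (/ cos x - 1) ^ 2) 2 - 1)));
      [| apply continuous_Kval_0].
    apply (continuous_comp (fun x => 2 + 4 * (/ cos x - 1) + (/ cos x - 1) ^ 2)
      (fun A => 2 * PI * (jensen A 2 - 1))).
    + apply continuous_of_ex_derive; auto_derive; rewrite cos_0; lra.
    + apply (continuous_comp (fun A => jensen A 2) (fun v => 2 * PI * (v - 1)));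
        [| apply continuous_of_ex_derive; now auto_derive].
      (* The radicand vanishes at A = 2, where sqrt is continuous but not differentiable, so
         continuity is assembled by hand. *)
      unfold jensen.
      apply (continuous_mult (fun A => A + sqrt (A ^ 2 - 2 ^ 2))); [| apply continuous_const].
      apply (continuous_plus (V := R_NormedModule) (fun A : R => A) (fun A => sqrt (A ^ 2 - 2 ^ 2)));
        [apply continuous_id |].
      apply (continuous_comp (fun A => A ^ 2 - 2 ^ 2) sqrt); [| apply continuous_sqrt].
      apply continuous_of_ex_derive; now auto_derive.
  - intros x Hx; rewrite (Hconst x Hx); pose proof (K_le _ (inv_cos_sub_1_pos x Hx)); unfold f; lra. }
assert (H2 : - c <= 0).
{ rewrite <- Kval_0; apply le_of_continuous_right with (PI / 2); [lra | apply continuous_Kval_0 |].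
  intros x Hx; rewrite (Hconst x Hx); pose proof (K_ge_0 _ (inv_cos_sub_1_pos x Hx)); lra. }
unfold c in *; lra.
Qed.

(** At b = pi/3 both b/2 and pi/2 - b equal pi/6, whence 20 = 4 (4 + 1); the logarithm cancels
    against [Phi (PI / 2)]. *)
Lemma K_1 : K 1 = 20 * Phi (PI / 6).
Proof.
pose proof PI_RGT_0.
replace 1 with (/ cos (PI / 3) - 1) by (rewrite cos_PI3; field).
rewrite K_eq by lra; unfold Kval.
rewrite Phi_PI2, cos_PI3.
replace (PI / 3 / 2) with (PI / 6) by field; replace (PI / 2 - PI / 3) with (PI / 6) by field.
replace (1 / 2) with (/ 2) by field; rewrite ln_Rinv by lra; field.
Qed.

(** * Removing the cutoff *)

(* 2 cos s + 2 cos (s - t) = 4 cos (t/2) cos (s - t/2) puts the symbol in the form A - B cos. *)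
Definition symbA (t : R) : R := 6 - 2 * cos t.
Definition symbB (t : R) : R := 4 * cos (t / 2).
Definition symb (t s : R) : R := symbA t - symbB t * cos (s + - (t / 2)).

Lemma symbA_half (t : R) : symbA t = 4 + 4 * sin (t / 2) ^ 2.
Proof. unfold symbA; pose proof (cos_half_sin t); lra. Qed.

Lemma symb_ge_0 (t s : R) : 0 <= symb t s.
Proof.
unfold symb, symbB; rewrite symbA_half; pose proof (pow2_ge_0 (sin (t / 2))).
pose proof (COS_bound (t / 2)); pose proof (COS_bound (s + - (t / 2))); nra.
Qed.

Lemma Cnorm_pL (t s : R) : Cnorm (pL (Cexpi t) (Cexpi s)) = symb t s.
Proof.
assert (E : symb t s = 6 - (2 * cos s + 2 * cos t + 2 * (cos t * cos s + sin t * sin s))).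
{ unfold symb, symbA, symbB; rewrite <- cos_minus.
  replace (cos s) with (cos ((s + - (t / 2)) + t / 2)) by (f_equal; field).
  replace (cos (t - s)) with (cos ((s + - (t / 2)) - t / 2))
    by (rewrite <- cos_neg; f_equal; field).
  set (y := s + - (t / 2)); rewrite cos_plus, cos_minus; ring. }
assert (E2 : pL (Cexpi t) (Cexpi s) = (symb t s, 0)).
{ pose proof (sin2_cos2 t) as Ht; pose proof (sin2_cos2 s) as Hs; unfold Rsqr in Ht, Hs.
  unfold pL, Csub, Cadd, Cdiv, Cmul, Cinv, Cof, Cexpi, Cre, Cim; cbn [fst snd].
  replace (cos t ^ 2 + sin t ^ 2) with 1 by lra; replace (cos s ^ 2 + sin s ^ 2) with 1 by lra.
  rewrite E; f_equal; field. }
rewrite E2; unfold Cnorm, Cre, Cim; cbn [fst snd].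
rewrite pow_i, Rplus_0_r by lia; apply sqrt_pow2, symb_ge_0.
Qed.

(** * Continuity of the truncated integrals *)

Lemma continuity_pt_Rmax (a x : R) : continuity_pt (Rmax a) x.
Proof.
intros eps Heps; exists eps; split; [easy |].
intros y [_ Hy]; simpl in *; unfold Rdist in *.
apply Rabs_lt_between in Hy; apply Rabs_lt_between.
unfold Rmax; destruct (Rle_dec a y), (Rle_dec a x); lra.
Qed.

Lemma continuous_RInt_param (f : R -> R -> R) (a b x : R) : a < b ->
  (forall u v, continuity_2d_pt f u v) -> continuous (fun u => RInt (f u) a b) x.
Proof.
intros Hab Hf; apply continuity_pt_filterlim; intros eps Heps.
(* The factor 2 makes the final estimate strict, since the integral bound is not. *)
assert (He : 0 < eps / (2 * (b - a))) by (apply Rdiv_lt_0_compat; lra).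
destruct (uniform_continuity_2d_1d' f a b x (fun v _ => Hf x v) (mkposreal _ He)) as [del Hdel].
assert (Hex : forall u, ex_RInt (f u) a b) by (intros u; apply ex_RInt_cont; intros; now apply continuous_of_2d).
exists del; split; [apply cond_pos |].
intros y [_ Hy]; simpl in *; unfold Rdist in *.
apply Rabs_lt_between in Hy; pose proof (cond_pos del).
rewrite <- (@RInt_minus R_CompleteNormedModule (f y) (f x)) by easy.
apply Rle_lt_trans with ((b - a) * (eps / (2 * (b - a)))).
- apply abs_RInt_le_const; [lra | |].
  + now apply (@ex_RInt_minus R_NormedModule).
  + intros t Ht; left; apply (Hdel t x t y); try lra.
    rewrite Rminus_diag, Rabs_R0; apply cond_pos.
- field_simplify; lra.
Qed.

Definition cutoff (d t s : R) : R := ln (Rmax d (symb t s)).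

Lemma continuity_2d_pt_symb (t s : R) : continuity_2d_pt symb t s.
Proof.
assert (Hc : forall f : R -> R, (forall x, ex_derive f x) -> continuity_2d_pt (fun u _ => f u) t s).
{ intros f Hf; apply (continuity_1d_2d_pt_comp f (fun u _ => u)); [| apply continuity_2d_pt_id1].
  now apply continuity_pt_of_ex_derive. }
unfold symb, symbA, symbB; apply continuity_2d_pt_minus.
- apply (Hc (fun t => 6 - 2 * cos t)); intros; now auto_derive.
- apply continuity_2d_pt_mult.
  + apply (Hc (fun t => 4 * cos (t / 2))); intros; now auto_derive.
  + apply (continuity_1d_2d_pt_comp cos (fun u v => v + - (u / 2))).
    * apply continuity_pt_of_ex_derive; now auto_derive.
    * apply continuity_2d_pt_plus; [apply continuity_2d_pt_id2 |].
      apply (Hc (fun t => - (t / 2))); intros; now auto_derive.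
Qed.

Lemma continuity_2d_pt_cutoff (d t s : R) : 0 < d -> continuity_2d_pt (cutoff d) t s.
Proof.
intros Hd; apply (continuity_1d_2d_pt_comp (fun y => ln (Rmax d y)) symb);
  [| apply continuity_2d_pt_symb].
apply (continuity_pt_comp (Rmax d) ln); [apply continuity_pt_Rmax |].
apply continuity_pt_of_ex_derive; auto_derive.
pose proof (Rmax_l d (symb t s)); lra.
Qed.

Lemma jensen_symb (t : R) : 0 <= t <= 2 * PI -> jensen (symbA t) (symbB t) = 2 * karg 1 t.
Proof.
intros Ht; pose proof (sin_half_ge_0 t Ht) as Hs; pose proof (rad_pos 1 t ltac:(lra)) as Hr.
pose proof (sin2_cos2 (t / 2)) as SC; unfold Rsqr in SC.
unfold jensen, karg.
replace (symbA t ^ 2 - symbB t ^ 2) with ((4 * sin (t / 2)) ^ 2 * rad 1 t).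
- rewrite sqrt_mult_alt, sqrt_pow2 by nra; rewrite symbA_half; field.
- rewrite symbA_half; unfold symbB, rad.
  replace ((4 * cos (t / 2)) ^ 2) with (16 * (1 - sin (t / 2) ^ 2)) by nra; ring.
Qed.

(** At t = 0 and t = 2 pi equality holds and the symbol has its zero; the outer integrals are
    compared on the open interval only. *)
Lemma symbB_lt_A (t : R) : 0 < t < 2 * PI -> Rabs (symbB t) < symbA t.
Proof.
intros Ht; rewrite symbA_half; unfold symbB.
assert (0 < sin (t / 2)) by (apply sin_gt_0; lra).
pose proof (COS_bound (t / 2)); apply Rabs_def1; nra.
Qed.

Lemma RInt_cutoff_ge (d t : R) : 0 < d -> 0 < t < 2 * PI ->
  2 * PI * kint 1 t <= RInt (cutoff d t) 0 (2 * PI).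
Proof.
intros Hd Ht; pose proof PI_RGT_0; pose proof (symbB_lt_A t Ht) as HBA.
unfold kint; rewrite <- jensen_symb, <- (RInt_ln_cos _ _ (- (t / 2)) HBA) by lra.
apply RInt_le; [lra | | |].
- apply ex_RInt_cont; intros x; apply continuous_of_ex_derive; auto_derive.
  now apply sub_mult_cos_pos.
- apply ex_RInt_cont; intros x; now apply continuous_of_2d, continuity_2d_pt_cutoff.
- intros s _; apply ln_le; [now apply sub_mult_cos_pos | apply Rmax_r].
Qed.

Lemma sqrt_plus_le (a b : R) : 0 <= a -> 0 <= b -> sqrt (a + b) <= sqrt a + sqrt b.
Proof.
intros Ha Hb; pose proof (sqrt_pos a); pose proof (sqrt_pos b).
rewrite <- (sqrt_pow2 (sqrt a + sqrt b)) by lra; apply sqrt_le_1_alt.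
pose proof (sqrt_sqrt a Ha); pose proof (sqrt_sqrt b Hb); nra.
Qed.

(** For A <= 8, adding d to A raises A^2 - B^2 by at most 16 d + d^2, hence [jensen] by at most
    twice this quantity; division by [jensen A B] >= 2 turns that into the error of the logarithm.
    The bound is uniform in t. *)
Definition cutoff_err (d : R) : R := (d + sqrt (16 * d + d ^ 2)) / 4.

Lemma ln_jensen_le (A B d : R) : 0 < d -> 4 <= A <= 8 -> Rabs B < A ->
  ln (jensen (A + d) B) <= ln (jensen A B) + cutoff_err d.
Proof.
intros Hd HA HB; apply Rabs_lt_between in HB.
assert (HS : 0 <= A ^ 2 - B ^ 2) by nra.
assert (H2 : 2 <= jensen A B) by (unfold jensen; pose proof (sqrt_pos (A ^ 2 - B ^ 2)); lra).
assert (Hd' : jensen (A + d) B <= jensen A B + 2 * cutoff_err d).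
{ unfold jensen, cutoff_err.
  assert (sqrt ((A + d) ^ 2 - B ^ 2) <= sqrt ((A ^ 2 - B ^ 2) + (16 * d + d ^ 2)))
    by (apply sqrt_le_1_alt; nra).
  pose proof (sqrt_plus_le (A ^ 2 - B ^ 2) (16 * d + d ^ 2) HS ltac:(nra)); lra. }
pose proof (jensen_pos (A + d) B ltac:(lra)) as Hp.
assert (Hq : 0 < jensen (A + d) B / jensen A B) by (apply Rdiv_lt_0_compat; lra).
assert (E : ln (jensen (A + d) B) = ln (jensen A B) + ln (jensen (A + d) B / jensen A B)).
{ rewrite <- ln_mult by lra; f_equal; field; lra. }
rewrite E; apply Rplus_le_compat_l.
apply Rle_trans with (jensen (A + d) B / jensen A B - 1);
  [now apply ln_le_minus_1 |].
assert (He : 0 <= cutoff_err d) by (unfold cutoff_err; pose proof (sqrt_pos (16 * d + d ^ 2)); lra).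
apply Rmult_le_reg_r with (jensen A B); [lra |].
field_simplify; [nra | lra].
Qed.

Lemma RInt_cutoff_le (d t : R) : 0 < d -> 0 < t < 2 * PI ->
  RInt (cutoff d t) 0 (2 * PI) <= 2 * PI * (kint 1 t + cutoff_err d).
Proof.
intros Hd Ht; pose proof PI_RGT_0; pose proof (symbB_lt_A t Ht) as HBA.
assert (HBA' : Rabs (symbB t) < symbA t + d) by lra.
apply Rle_trans with (2 * PI * ln (jensen (symbA t + d) (symbB t))).
- rewrite <- (RInt_ln_cos _ _ (- (t / 2)) HBA').
  apply RInt_le; [lra | | |].
  + apply ex_RInt_cont; intros x; now apply continuous_of_2d, continuity_2d_pt_cutoff.
  + apply ex_RInt_cont; intros x; apply continuous_of_ex_derive; auto_derive.
    now apply sub_mult_cos_pos.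
  + intros s _; pose proof (symb_ge_0 t s); pose proof (Rmax_l d (symb t s)).
    apply ln_le; [lra |]; unfold symb in *; apply Rmax_lub; lra.
- apply Rmult_le_compat_l; [lra |].
  unfold kint; rewrite <- jensen_symb by lra; apply ln_jensen_le; try easy.
  unfold symbA; pose proof (COS_bound t); lra.
Qed.

Definition cutoff_int (d : R) : R := RInt (fun t => RInt (cutoff d t) 0 (2 * PI)) 0 (2 * PI).

Lemma ex_RInt_cutoff (d : R) : 0 < d ->
  ex_RInt (fun t => RInt (cutoff d t) 0 (2 * PI)) 0 (2 * PI).
Proof.
intros Hd; pose proof PI_RGT_0; apply ex_RInt_cont; intros t.
apply continuous_RInt_param; [lra |]; intros; now apply continuity_2d_pt_cutoff.
Qed.

Lemma cutoff_int_ge (d : R) : 0 < d -> 2 * PI * K 1 <= cutoff_int d.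
Proof.
intros Hd; pose proof PI_RGT_0; unfold K, cutoff_int.
pose proof (ex_RInt_kint 1 ltac:(lra)) as Hk.
change (2 * PI * RInt (kint 1) 0 (2 * PI)) with (scal (2 * PI) (RInt (kint 1) 0 (2 * PI))).
rewrite <- (@RInt_scal R_CompleteNormedModule (kint 1) 0 (2 * PI) (2 * PI) Hk).
apply RInt_le; [lra | now apply (@ex_RInt_scal R_NormedModule) | now apply ex_RInt_cutoff |].
intros t Ht; now apply RInt_cutoff_ge.
Qed.

Lemma cutoff_int_le (d : R) : 0 < d -> cutoff_int d <= 2 * PI * (K 1 + 2 * PI * cutoff_err d).
Proof.
intros Hd; pose proof PI_RGT_0.
pose proof (@RInt_correct R_CompleteNormedModule _ _ _ (ex_RInt_kint 1 ltac:(lra))) as Hk.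
assert (Hr : RInt.is_RInt (fun t => 2 * PI * (kint 1 t + cutoff_err d)) 0 (2 * PI)
  (2 * PI * (K 1 + (2 * PI - 0) * cutoff_err d))).
{ apply (@is_RInt_scal R_NormedModule), (@is_RInt_plus R_NormedModule); [exact Hk |].
  apply (@is_RInt_const R_NormedModule). }
rewrite Rminus_0_r in Hr.
apply (is_RInt_le (fun t => RInt (cutoff d t) 0 (2 * PI))
  (fun t => 2 * PI * (kint 1 t + cutoff_err d)) 0 (2 * PI)); [lra | | exact Hr |].
- now apply (@RInt_correct R_CompleteNormedModule), ex_RInt_cutoff.
- intros t Ht; now apply RInt_cutoff_le.
Qed.

Lemma is_mahler_pL (m : R) : 4 * PI ^ 2 * m = 2 * PI * K 1 -> is_mahler pL m.
Proof.
intros Hm; exists (fun n => cutoff_int (/ INR (S n))); split.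
- intros n; assert (Hd : 0 < / INR (S n)) by (apply Rinv_0_lt_compat, lt_0_INR; lia).
  exists (fun t => RInt (cutoff (/ INR (S n)) t) 0 (2 * PI)); split.
  + intros t; apply is_RInt_Defs.
    apply (@is_RInt_ext R_NormedModule (cutoff (/ INR (S n)) t)).
    { intros s _; now rewrite Cnorm_pL. }
    apply (@RInt_correct R_CompleteNormedModule), ex_RInt_cont; intros s.
    now apply continuous_of_2d, continuity_2d_pt_cutoff.
  + now apply is_RInt_Defs, (@RInt_correct R_CompleteNormedModule), ex_RInt_cutoff.
- rewrite Hm; apply is_lim_seq_Reals.
  apply is_lim_seq_le_le with (fun _ => 2 * PI * K 1)
    (fun n => 2 * PI * (K 1 + 2 * PI * cutoff_err (/ INR (S n)))).
  + intros n; assert (Hd : 0 < / INR (S n)) by (apply Rinv_0_lt_compat, lt_0_INR; lia).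
    split; [now apply cutoff_int_ge | now apply cutoff_int_le].
  + apply is_lim_seq_const.
  + replace (2 * PI * K 1) with (2 * PI * (K 1 + 2 * PI * cutoff_err 0)).
    * apply (is_lim_seq_continuous (fun d => 2 * PI * (K 1 + 2 * PI * cutoff_err d))).
      -- apply continuity_pt_filterlim.
         apply (continuous_comp cutoff_err (fun v => 2 * PI * (K 1 + 2 * PI * v)));
           [| apply continuous_of_ex_derive; now auto_derive].
         unfold cutoff_err; apply (continuous_mult (fun d => d + sqrt (16 * d + d ^ 2)));
           [| apply continuous_const].
         apply (continuous_plus (V := R_NormedModule) (fun d : R => d) (fun d => sqrt (16 * d + d ^ 2)));
           [apply continuous_id |].
         apply (continuous_comp (fun d => 16 * d + d ^ 2) sqrt); [| apply continuous_sqrt].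
         apply continuous_of_ex_derive; now auto_derive.
      (* The cutoffs 1/(n+1) are the shift of 1/n, so the undefined reciprocal at n = 0 is
         skipped. *)
      -- apply (is_lim_seq_incr_1 (fun n => / INR n)).
         apply (is_lim_seq_inv INR p_infty); [apply is_lim_seq_INR | easy].
    * unfold cutoff_err; replace (16 * 0 + 0 ^ 2) with 0 by ring; rewrite sqrt_0; field.
Qed.

(* 2 pi m(p_L) = 10 D((1+sqrt3 i)/2) = 10 v_tet, v_tet = D(e^{i pi/3}). *)
Theorem theorem4p2 :
  exists m d vtet : R,
    is_mahler pL m /\
    is_BW (1 / 2, sqrt 3 / 2) d /\
    is_BW (Cexpi (PI / 3)) vtet /\
    2 * PI * m = 10 * d /\
    10 * d = 10 * vtet.
Proof.
pose proof PI_RGT_0; set (d := 2 * Phi (PI / 6)).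
exists (10 * d / (2 * PI)), d, d; repeat split.
- apply is_mahler_pL; rewrite K_1; unfold d; field; lra.
- apply is_BW_PI3.
- unfold Cexpi; rewrite cos_PI3, sin_PI3; apply is_BW_PI3.
- field; lra.
Qed.
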